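(* Let $n\ge1$ be fixed and let $f(\boldsymbol{X})$ be a probability density of the joint vector state $\boldsymbol{X}=(x_1,\dots,x_n)$ of $n$ targets, and let $g(\boldsymbol{X})=\mathcal{N}\{\boldsymbol{X};\boldsymbol{\mu},\boldsymbol{\Sigma}\}$ be a Gaussian density. Define $$J(g)=\min_{\tilde f}\ \int\tilde f(\boldsymbol{X})\log\frac{\tilde f(\boldsymbol{X})}{g(\boldsymbol{X})}\,\mathrm{d}\boldsymbol{X}\quad\text{subject to}\quad\sum_{\pi}\tilde f(\pi\boldsymbol{X})=\sum_{\pi}f(\pi\boldsymbol{X})\ \ \forall\boldsymbol{X},$$ the minimum being over probability densities $\tilde f$. Then $$J(g)=\frac{1}{n!}\int\Big[\sum_{\pi}f(\pi\boldsymbol{X})\Big]\log\frac{\sum_{\pi}f(\pi\boldsymbol{X})}{\sum_{\pi}g(\pi\boldsymbol{X})}\,\mathrm{d}\boldsymbol{X}.$$ Consequently, the problem of minimising $\int\tilde f\log(\tilde f/g)\,\mathrm{d}\boldsymbol{X}$ jointly over such $\tilde f$ and Gaussian $g$ is equivalent to minimising the right-hand side over Gaussian $g$.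
   Context: Sums over $\pi$ range over all $n!$ permutations of the $n$ single-target components, and $\pi\boldsymbol{X}$ denotes the vector $\boldsymbol{X}$ with its $n$ single-target components permuted according to $\pi$. *)

(* Defs.v *)
From HB Require Import structures.
From mathcomp Require Import all_boot all_order all_algebra all_fingroup.
From mathcomp Require Import all_classical all_reals all_analysis.

Set Implicit Arguments.
Unset Strict Implicit.
Unset Printing Implicit Defensive.

Import Order.TTheory GRing.Theory Num.Theory.
Local Open Scope classical_set_scope.
Local Open Scope ring_scope.

(* Joint state of n targets, each single-target state x_i in R^d:
   X : n.-tuple (d.-tuple R), with the product sigma-algebra of the
   Borel sigma-algebras (library instance on tuples). *)
Definition jstate (R : realType) (n d : nat) := n.-tuple (d.-tuple R).

Definition coord (R : realType) (n d : nat) (X : jstate R n d)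
  (i : 'I_n) (j : 'I_d) : R := tnth (tnth X i) j.

Definition box (R : realType) (n d : nat) (a b : jstate R n d)
  : set (jstate R n d) :=
  [set X | forall i j, coord a i j <= coord X i j <= coord b i j].

(* lam is the Lebesgue measure on R^(n*d): it gives every closed box its
   volume (this determines it uniquely on the product sigma-algebra). *)
Definition is_lebesgue (R : realType) (n d : nat)
  (lam : {measure set (jstate R n d) -> \bar R}) : Prop :=
  forall a b : jstate R n d, (forall i j, coord a i j <= coord b i j) ->
    lam (box a b) = (\prod_(i < n) \prod_(j < d) (coord b i j - coord a i j))%:E.

Definition permX (R : realType) (n d : nat) (p : 'S_n) (X : jstate R n d)
  : jstate R n d := [tuple tnth X (p i) | i < n].

Definition symsum (R : realType) (n d : nat) (h : jstate R n d -> R)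
  (X : jstate R n d) : R := \sum_(p : 'S_n) h (permX p X).

Definition is_density (R : realType) (n d : nat)
  (lam : {measure set (jstate R n d) -> \bar R}) (h : jstate R n d -> R) : Prop :=
  measurable_fun setT h /\ (forall X, 0 <= h X) /\
  (\int[lam]_X (h X)%:E = 1)%E.

Definition xlogxy (R : realType) (a b : R) : R :=
  if a == 0 then 0 else a * ln (a / b).

Definition KL (R : realType) (n d : nat)
  (lam : {measure set (jstate R n d) -> \bar R}) (h k : jstate R n d -> R)
  : \bar R := \int[lam]_X (xlogxy (h X) (k X))%:E.

Definition vecX (R : realType) (n d : nat) (X : jstate R n d) : 'rV[R]_(n * d) :=
  mxvec (\matrix_(i < n, j < d) coord X i j).

Definition spd (R : realType) (k : nat) (S : 'M[R]_k) : Prop :=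
  S^T = S /\ forall v : 'rV[R]_k, v != 0 -> 0 < (v *m S *m v^T) 0 0.

Definition gauss (R : realType) (n d : nat) (mu : 'rV[R]_(n * d))
  (S : 'M[R]_(n * d)) (X : jstate R n d) : R :=
  let v := vecX X - mu in
  expR (- ((v *m invmx S *m v^T) 0 0) / 2) /
  Num.sqrt ((2 * pi) ^+ (n * d) * \det S).

Definition Jrhs (R : realType) (n d : nat)
  (lam : {measure set (jstate R n d) -> \bar R}) (f g : jstate R n d -> R)
  : \bar R :=
  ((n`!%:R)^-1)%:E * \int[lam]_X (xlogxy (symsum f X) (symsum g X))%:E.

Definition feasible (R : realType) (n d : nat)
  (lam : {measure set (jstate R n d) -> \bar R}) (f ft : jstate R n d -> R) : Prop :=
  is_density lam ft /\ forall X, symsum ft X = symsum f X.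

Definition joint_values (R : realType) (n d : nat)
  (lam : {measure set (jstate R n d) -> \bar R}) (f : jstate R n d -> R)
  : set (\bar R) :=
  [set x | exists ft (mu : 'rV[R]_(n * d)) (S : 'M[R]_(n * d)),
     [/\ feasible lam f ft, spd S & x = KL lam ft (gauss mu S)]].

Definition reduced_values (R : realType) (n d : nat)
  (lam : {measure set (jstate R n d) -> \bar R}) (f : jstate R n d -> R)
  : set (\bar R) :=
  [set x | exists (mu : 'rV[R]_(n * d)) (S : 'M[R]_(n * d)),
     spd S /\ x = Jrhs lam f (gauss mu S)].

(* Main.v *)
(* Write F and G for the symmetrisations of f and g, and L = ln (F / G).
   Lebesgue measure is invariant under permutation of the targets, so that
   int w phi = 1/n! int (symsum w) phi for symmetric phi; with phi = L, every
   feasible ft satisfies int ft L = 1/n! int F L = Jrhs.  The density g F / G is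
   feasible and its KL integrand is exactly (g F / G) L, so it attains Jrhs.  For
   any other ft, Gibbs' inequality gives
   ft ln (ft / g) >= ft L + (ft - g F / G), where the bracket integrates to 0. *)
From Pilot Require Import Defs.
From HB Require Import structures.
From mathcomp Require Import all_boot all_order all_algebra all_fingroup.
From mathcomp Require Import all_classical all_reals all_analysis.
From mathcomp Require Import measurable_realfun ring lra.
Import Order.TTheory GRing.Theory Num.Theory.
(* [coord] is shadowed by the one of mathcomp's vector library. *)
Import Pilot.Defs.
Local Open Scope classical_set_scope.
Local Open Scope ring_scope.

(** * Coordinates and permutations of joint states, and their measurability *)

Definition mkstate {R : realType} {n d : nat} (F : 'I_n -> 'I_d -> R) :
  jstate R n d := [tuple [tuple F i j | j < d] | i < n].

Lemma coord_mkstate {R : realType} {n d : nat} (F : 'I_n -> 'I_d -> R) i j :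
  coord (mkstate F) i j = F i j.
Proof. by rewrite /coord !tnth_mktuple. Qed.

Lemma coord_permX {R : realType} {n d : nat} (p : 'S_n) (X : jstate R n d) i j :
  coord (permX p X) i j = coord X (p i) j.
Proof. by rewrite /coord tnth_mktuple. Qed.

(** Products in ['S_n] compose from left to right, while [permX] acts on indices; hence the
    permutation applied last is the left factor. *)
Lemma permXM {R : realType} {n d : nat} (p q : 'S_n) (X : jstate R n d) :
  permX q (permX p X) = permX (q * p)%g X.
Proof. by apply: eq_from_tnth => i; rewrite !tnth_mktuple permM. Qed.

Lemma permX1 {R : realType} {n d : nat} (X : jstate R n d) : permX 1%g X = X.
Proof. by apply: eq_from_tnth => i; rewrite tnth_mktuple perm1. Qed.

Lemma coord_bounded {R : realType} {n d : nat} (X : jstate R n d) :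
  exists k : nat, forall i j, `|coord X i j| <= k%:R.
Proof.
pose s := \sum_(i < n) \sum_(j < d) `|coord X i j|.
have s_ge0 : 0 <= s by apply: sumr_ge0 => i _; apply: sumr_ge0.
exists (Num.bound s) => i j.
apply: le_trans (ltW (archi_boundP s_ge0)).
rewrite /s (bigD1 i)//= (bigD1 j)//= -addrA lerDl addr_ge0//.
- by apply: sumr_ge0.
- by apply: sumr_ge0 => k _; apply: sumr_ge0.
Qed.

Lemma measurable_coord {R : realType} {n d : nat} (i : 'I_n) (j : 'I_d) :
  measurable_fun setT (fun X : jstate R n d => coord X i j).
Proof.
exact: (measurableT_comp (@measurable_tnth _ _ d j) (@measurable_tnth _ _ n i)).
Qed.

Lemma measurable_permX {R : realType} {n d : nat} (p : 'S_n) :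
  measurable_fun setT (@permX R n d p).
Proof.
apply: (measurable_fun_tnthP (@permX R n d p)).2 => i.
rewrite [X in measurable_fun _ X](_ : _ = fun X => tnth X (p i)).
  exact: measurable_tnth.
by apply/funext => X /=; rewrite tnth_mktuple.
Qed.

Lemma measurable_box {R : realType} {n d : nat} (a b : jstate R n d) :
  measurable (box a b).
Proof.
have -> : box a b = \bigcap_(i in [set: 'I_n]) \bigcap_(j in [set: 'I_d])
    ((fun X => coord X i j) @^-1` `[coord a i j, coord b i j]).
  apply/seteqP; split => X /= h i; last by move=> j; have := h i I j I; rewrite /= in_itv.
  by move=> _ j _ /=; rewrite in_itv; exact: h.
apply: fin_bigcap_measurable => // i _; apply: fin_bigcap_measurable => // j _.
rewrite -[X in measurable X]setTI.
exact: (measurable_coord i j measurableT _ (measurable_itv _)).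
Qed.

(** * Closed boxes as a generating pi-system *)

Definition boxes (R : realType) (n d : nat) : set (set (jstate R n d)) :=
  [set A | exists a b, A = box a b].

Lemma boxes_box {R : realType} {n d : nat} (a b : jstate R n d) :
  boxes R n d (box a b).
Proof. by exists a, b. Qed.

Lemma setI_closed_boxes {R : realType} {n d : nat} : setI_closed (boxes R n d).
Proof.
move=> _ _ [a [b ->]] [a' [b' ->]].
exists (mkstate (fun i j => Num.max (coord a i j) (coord a' i j))).
exists (mkstate (fun i j => Num.min (coord b i j) (coord b' i j))).
apply/seteqP; split => X /=.
  move=> [h h'] i j; rewrite !coord_mkstate.
  by rewrite ge_max le_min; case/andP: (h i j) => -> ->; case/andP: (h' i j) => -> ->.
by move=> h; split=> i j; have := h i j; rewrite !coord_mkstate ge_max le_min;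
  case/andP => /andP[h1 h2] /andP[h3 h4]; apply/andP.
Qed.

(** The face at [x] stays fixed while all the other faces recede to infinity. *)
Lemma preimage_coord_boxes {R : realType} {n d : nat} (i : 'I_n) (j : 'I_d) (x : R) :
  (fun X : jstate R n d => coord X i j) @^-1` `[x, +oo[ =
  \bigcup_(k : nat)
    box (mkstate (fun i' j' => if (i' == i) && (j' == j) then x else - k%:R))
        (mkstate (fun _ _ => k%:R)).
Proof.
apply/seteqP; split => X /=; rewrite in_itv /= andbT; last first.
  move=> [k _ h]; have := h i j; rewrite !coord_mkstate !eqxx.
  by case/andP.
move=> xX; have [k hk] := coord_bounded X.
exists k => // i' j'; rewrite !coord_mkstate.
have := hk i' j'; rewrite ler_norml => /andP[h1 h2]; rewrite h2 andbT.
by case: ifP => // /andP[/eqP -> /eqP ->].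
Qed.

(** The product sigma-algebra is the least one making all coordinates measurable, and half-lines
    generate the Borel sets of the line; so it suffices that preimages of half-lines are generated
    by boxes. *)
Lemma measurable_boxes {R : realType} {n d : nat} :
  @measurable _ (jstate R n d) = <<s boxes R n d >>.
Proof.
apply/seteqP; split => [A mA|]; last first.
  apply: smallest_sub; first exact: sigma_algebra_measurable.
  by move=> _ [a [b ->]]; exact: measurable_box.
(* Without this pointed structure, T would unfold to the product sigma-algebra. *)
pose P : pointedType :=
  HB.pack (n.-tuple (d.-tuple R))
    (isPointed.Build (n.-tuple (d.-tuple R)) (mkstate (fun _ _ => 0))).
pose T : measurableType _ := g_sigma_algebraType (boxes R n d : set (set P)).
have mcoord i j x :
    @measurable _ T ((fun X : jstate R n d => coord X i j) @^-1` `[x, +oo[).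
  rewrite preimage_coord_boxes; apply: (@bigcup_measurable _ T) => k _.
  exact: (@sub_sigma_algebra _ setT (boxes R n d) _ (boxes_box _ _)).
(* Measurability of the identity from the box sigma-algebra to the product one is the remaining
   inclusion. *)
have mid : @measurable_fun _ _ T (jstate R n d) setT (fun X => X).
  apply: (measurable_fun_tnthP (T1 := T) (T2 := d.-tuple R) (fun X => X)).2 => i.
  apply: (measurable_fun_tnthP (T1 := T) (fun X => tnth X i)).2 => j.
  apply: (measurability (aT := T) _ (RGenCInfty.measurableE R)).
  by move=> _ [_ [x ->] <-]; rewrite setTI; exact: mcoord.
by have := mid measurableT A mA; rewrite setTI.
Qed.

Lemma bigcup_cubes {R : realType} {n d : nat} :
  \bigcup_(k : nat) box (mkstate (fun _ _ => - k%:R)) (mkstate (fun _ _ => k%:R))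
  = [set: jstate R n d].
Proof.
apply/seteqP; split => // X _; have [k hk] := coord_bounded X.
by exists k => // i j; rewrite !coord_mkstate -ler_norml.
Qed.

(** * Invariance of Lebesgue measure under permutation of the targets *)

Lemma lebesgue_box_perm {R : realType} {n d : nat}
  (lam : {measure set (jstate R n d) -> \bar R}) (p : 'S_n) (a b : jstate R n d) :
  is_lebesgue lam -> lam (permX p @^-1` box a b) = lam (box a b).
Proof.
move=> hlam.
have -> : permX p @^-1` box a b = box (permX p^-1%g a) (permX p^-1%g b).
  apply/seteqP; split => X /= h i j.
    by have := h ((p^-1)%g i) j; rewrite !coord_permX permKV.
  by have := h (p i) j; rewrite !coord_permX permK.
(* [is_lebesgue] gives volumes only for ordered corners, where the product of side lengths is
   reindexed; otherwise both boxes are empty. *)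
have [ab|nab] := pselect (forall i j, coord a i j <= coord b i j).
  rewrite !hlam//; last by move=> i j; rewrite !coord_permX.
  congr EFin; rewrite (reindex_inj (@perm_inj _ p)) /=.
  by apply: eq_bigr => i _; apply: eq_bigr => j _; rewrite !coord_permX permK.
suff box0 (u v : jstate R n d) : ~ (forall i j, coord u i j <= coord v i j) -> box u v = set0.
  rewrite !box0// => h; apply: nab => i j.
  by have := h (p i) j; rewrite !coord_permX permK.
move=> nuv; apply/seteqP; split => // X /= h; apply: nuv => i j.
by have /andP[h1 h2] := h i j; exact: le_trans h1 h2.
Qed.

(** Both measures agree on a generating pi-system, and cubes of finite measure exhaust the space, so
    uniqueness of measures applies. *)
Lemma lebesgue_perm {R : realType} {n d : nat}
  (lam : {measure set (jstate R n d) -> \bar R}) (p : 'S_n) (A : set (jstate R n d)) :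
  is_lebesgue lam -> measurable A -> lam A = pushforward lam (permX p) A.
Proof.
move=> hlam mA.
apply: (measure_unique (boxes R n d) _ measurable_boxes setI_closed_boxes _
          bigcup_cubes) => //.
- by move=> k; exact: boxes_box.
- exact: measurable_permX.
- by move=> ? _ [a [b ->]]; rewrite /= /pushforward lebesgue_box_perm.
- by move=> k; rewrite hlam ?ltry// => i j; rewrite !coord_mkstate ge0_cp.
Qed.

Lemma integral_permX {R : realType} {n d : nat}
  (lam : {measure set (jstate R n d) -> \bar R}) (p : 'S_n)
  (phi : jstate R n d -> \bar R) :
  is_lebesgue lam -> measurable_fun setT phi -> (forall X, 0 <= phi X)%E ->
  (\int[lam]_X phi (permX p X) = \int[lam]_X phi X)%E.
Proof.
move=> hlam mphi phi0.
rewrite -(ge0_integral_pushforward (measurable_permX p) lam measurableT mphi)//.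
apply/esym/eq_measure_integral => [|mp A mA _]; first exact: measurable_permX.
by rewrite [LHS](lebesgue_perm lam p A).
Qed.

(** * Symmetrised sums and their integrals against symmetric functions *)

Lemma measurable_symsum {R : realType} {n d : nat} {h : jstate R n d -> R} :
  measurable_fun setT h -> measurable_fun setT (symsum h).
Proof.
move=> mh; apply: measurable_sum => p.
exact: (measurableT_comp mh (measurable_permX p)).
Qed.

Lemma symsum_permX {R : realType} {n d : nat} (h : jstate R n d -> R) (p : 'S_n) X :
  symsum h (permX p X) = symsum h X.
Proof.
rewrite /symsum [RHS](reindex_inj (mulIg p)) /=.
by apply: eq_bigr => q _; rewrite permXM.
Qed.

Lemma le_symsum {R : realType} {n d : nat} (h : jstate R n d -> R) X :
  (forall Y, 0 <= h Y) -> h X <= symsum h X.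
Proof.
move=> h0; rewrite /symsum (bigD1 1%g)//= permX1 lerDl.
exact: sumr_ge0.
Qed.

Lemma symsum_ge0 {R : realType} {n d : nat} (h : jstate R n d -> R) X :
  (forall Y, 0 <= h Y) -> 0 <= symsum h X.
Proof. by move=> h0; apply: sumr_ge0. Qed.

Lemma integral_symsum_ge0 {R : realType} {n d : nat}
  (lam : {measure set (jstate R n d) -> \bar R}) (w phi : jstate R n d -> R) :
  is_lebesgue lam -> measurable_fun setT w -> measurable_fun setT phi ->
  (forall X, 0 <= w X) -> (forall X, 0 <= phi X) ->
  (forall p X, phi (permX p X) = phi X) ->
  (\int[lam]_X (w X * phi X)%:E =
   ((n`!%:R)^-1)%:E * \int[lam]_X (symsum w X * phi X)%:E)%E.
Proof.
move=> hlam mw mphi w0 phi0 phiP.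
have mwphi p : measurable_fun setT (fun X => (w (permX p X) * phi (permX p X))%:E).
  apply/measurable_EFinP; apply: measurable_funM.
    exact: (measurableT_comp mw (measurable_permX p)).
  exact: (measurableT_comp mphi (measurable_permX p)).
have mwphi1 : measurable_fun setT (fun X => (w X * phi X)%:E).
  by apply/measurable_EFinP; exact: measurable_funM.
under [in RHS]eq_integral => X _.
  rewrite /symsum mulr_suml -sumEFin.
  (* Symmetry of [phi] makes each summand the function [w * phi] composed with [permX p]; by
     invariance, all n! integrals coincide. *)
  under eq_bigr => p _ do rewrite -[in phi X](phiP p).
  over.
rewrite ge0_integral_sum//=; last by move=> p X _; rewrite lee_fin mulr_ge0.
under eq_bigr => p _.
  rewrite (integral_permX lam p (fun X => (w X * phi X)%:E))//; last first.
    by move=> X; rewrite lee_fin mulr_ge0.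
  over.
have natmulE k (y : \bar R) : y *+ k = (k%:R%:E * y)%E.
  elim: k => [|k IH]; first by rewrite mulr0n mul0e.
  by rewrite mulrS IH !mule_natl muleS.
by rewrite sumr_const card_Sn natmulE muleA -EFinM mulVf ?mul1e.
Qed.

(** Scaling by a positive finite number fixes both infinities, so the identity survives even for oo
    - oo. *)
Lemma EFin_muleBr {R : realDomainType} (r : R) (x y : \bar R) :
  0 < r -> (r%:E * (x - y) = r%:E * x - r%:E * y)%E.
Proof.
move=> r0.
have ry : (r%:E * +oo = +oo :> \bar R)%E by rewrite gt0_muley ?lte_fin.
have rNy : (r%:E * -oo = -oo :> \bar R)%E by rewrite gt0_muleNy ?lte_fin.
by case: x => [x| |]; case: y => [y| |];
  rewrite /= ?ry ?rNy //= ?ry ?rNy -?EFinM -?EFinD ?mulrBr.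
Qed.

(** As the weight is nonnegative, it factors out of the positive and negative parts of the
    integrand, and those parts of [phi] are again symmetric. *)
Lemma integral_symsum {R : realType} {n d : nat}
  (lam : {measure set (jstate R n d) -> \bar R}) (w phi : jstate R n d -> R) :
  is_lebesgue lam -> measurable_fun setT w -> measurable_fun setT phi ->
  (forall X, 0 <= w X) -> (forall p X, phi (permX p X) = phi X) ->
  (\int[lam]_X (w X * phi X)%:E =
   ((n`!%:R)^-1)%:E * \int[lam]_X (symsum w X * phi X)%:E)%E.
Proof.
move=> hlam mw mphi w0 phiP.
have posE (v : jstate R n d -> R) : (forall X, 0 <= v X) ->
    (fun X => (v X * phi X)%:E)^\+%E = (fun X => (v X * Num.max (phi X) 0)%:E).
  by move=> v0; apply/funext => X; rewrite funeposE -EFin_max maxr_pMr ?mulr0.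
have negE (v : jstate R n d -> R) : (forall X, 0 <= v X) ->
    (fun X => (v X * phi X)%:E)^\-%E = (fun X => (v X * Num.max (- phi X) 0)%:E).
  by move=> v0; apply/funext => X; rewrite funenegE -EFinN -EFin_max maxr_pMr ?mulr0 ?mulrN.
have sw0 X : 0 <= symsum w X by exact: symsum_ge0.
rewrite integralE [in RHS]integralE !posE// !negE//.
rewrite EFin_muleBr ?invr_gt0 ?ltr0n ?fact_gt0//.
congr (_ - _)%E; apply: integral_symsum_ge0 => //.
- exact: measurable_maxr.
- by move=> X; rewrite le_max lexx orbT.
- by move=> p X; rewrite phiP.
- by apply: measurable_maxr => //; exact: measurableT_comp.
- by move=> X; rewrite le_max lexx orbT.
- by move=> p X; rewrite phiP.
Qed.

(** * Comparison of possibly infinite integrals, and Gibbs' inequality *)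

(* The integrals of u and v may be infinite, with oo - oo = -oo: cancellation is
   done on the positive and negative parts. *)
Lemma le_integral_shift {d} {T : measurableType d} {R : realType}
  (mu : {measure set T -> \bar R}) (u v a b : T -> R) :
  measurable_fun setT u -> measurable_fun setT v ->
  measurable_fun setT a -> measurable_fun setT b ->
  (forall x, 0 <= a x) -> (forall x, 0 <= b x) ->
  (\int[mu]_x (a x)%:E = \int[mu]_x (b x)%:E)%E ->
  (\int[mu]_x (b x)%:E < +oo)%E ->
  (forall x, v x + a x <= u x + b x) ->
  (\int[mu]_x (v x)%:E <= \int[mu]_x (u x)%:E)%E.
Proof.
move=> measu mv ma mb a0 b0 ab boo h.
pose pos (f : T -> R) x : R := Num.max (f x) 0.
pose neg (f : T -> R) x : R := Num.max (- f x) 0.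
have pos0 f x : 0 <= pos f x by rewrite /pos le_max lexx orbT.
have neg0 f x : 0 <= neg f x by rewrite /neg le_max lexx orbT.
have posBneg f x : f x = pos f x - neg f x.
  by rewrite /pos /neg; case: (leP (f x) 0); case: (leP (- f x) 0); lra.
have mpos f : measurable_fun setT f -> measurable_fun setT (pos f).
  by move=> mf; exact: measurable_maxr.
have mneg f : measurable_fun setT f -> measurable_fun setT (neg f).
  by move=> mf; apply: measurable_maxr => //; exact: measurableT_comp.
have intE f : (\int[mu]_x (f x)%:E =
    \int[mu]_x (pos f x)%:E - \int[mu]_x (neg f x)%:E)%E.
  rewrite integralE; congr (_ - _)%E; apply: eq_integral => x _.
    by rewrite funeposE EFin_max.
  by rewrite funenegE EFin_max.
have intD (f g : T -> R) : measurable_fun setT f -> measurable_fun setT g ->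
    (forall x, 0 <= f x) -> (forall x, 0 <= g x) ->
    (\int[mu]_x (f x + g x)%:E = \int[mu]_x (f x)%:E + \int[mu]_x (g x)%:E)%E.
  move=> mf mg f0 g0; under eq_integral do rewrite EFinD.
  by rewrite ge0_integralD//; first [by move=> x _; rewrite lee_fin | exact/measurable_EFinP].
have intle (f g : T -> R) : measurable_fun setT f -> measurable_fun setT g ->
    (forall x, 0 <= f x) -> (forall x, f x <= g x) ->
    (\int[mu]_x (f x)%:E <= \int[mu]_x (g x)%:E)%E.
  move=> mf mg f0 fg; apply: ge0_le_integral => //;
  by [move=> x _; rewrite lee_fin | exact/measurable_EFinP].
have int0 (f : T -> R) : (forall x, 0 <= f x) -> (0 <= \int[mu]_x (f x)%:E)%E.
  by move=> f0; apply: integral_ge0 => x _; rewrite lee_fin.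
have [mpu mnu mpv mnv] : [/\ measurable_fun setT (pos u), measurable_fun setT (neg u),
    measurable_fun setT (pos v) & measurable_fun setT (neg v)] by split; auto.
(* From u >= v - b: if the negative part of [v] has finite integral, so has that of [u]. *)
have h1 : (\int[mu]_x (neg u x)%:E <= \int[mu]_x (neg v x)%:E + \int[mu]_x (b x)%:E)%E.
  rewrite -intD//; apply: intle => //; first exact: measurable_funD.
  move=> x; rewrite /neg ge_max addr_ge0 ?neg0// andbT.
  have := h x; have := a0 x; have := neg0 v x; have := pos0 v x; have := posBneg v x.
  rewrite -/(neg v x); lra.
(* The hypothesis [h] with negative parts moved across, so that every integrand is nonnegative. *)
have h2 : (\int[mu]_x (pos v x)%:E + \int[mu]_x (neg u x)%:E + \int[mu]_x (a x)%:E <=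
    \int[mu]_x (pos u x)%:E + \int[mu]_x (neg v x)%:E + \int[mu]_x (b x)%:E)%E.
  rewrite -!intD//; try (by move=> x; rewrite addr_ge0); try exact: measurable_funD.
  apply: intle.
  - by do ?apply: measurable_funD.
  - by do ?apply: measurable_funD.
  - by move=> x; rewrite !addr_ge0.
  by move=> x; have := h x; rewrite (posBneg u x) (posBneg v x); lra.
rewrite (intE u) (intE v); move: h1 h2; rewrite ab.
have := int0 _ (pos0 u); have := int0 _ (pos0 v).
have := int0 _ (neg0 u); have := int0 _ (neg0 v).
have := int0 _ b0; move: boo.
move: (\int[mu]_x (b x)%:E)%E => [b'| |]// _ _.
(* If this integral is infinite, the integral of [v] is -oo; otherwise [h1] makes that of [neg u]
   finite too. *)
move: (\int[mu]_x (neg v x)%:E)%E => [v'| |]// _; last by rewrite addeNy leNye.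
move: (\int[mu]_x (neg u x)%:E)%E => [u'| |]// _.
move: (\int[mu]_x (pos u x)%:E)%E (\int[mu]_x (pos v x)%:E)%E => [u''| |] [v''| |]// _ _ _.
  by rewrite -!EFinD !lee_fin; lra.
by move=> _; rewrite addye ?leey.
Qed.

Lemma xlogxyE {R : realType} (a b : R) : xlogxy a b = a * ln (a / b).
Proof. by rewrite /xlogxy; case: eqP => // ->; rewrite mul0r. Qed.

(** This is ln (1 + x) <= x at x = b / a - 1, multiplied by [a]. *)
Lemma gibbs {R : realType} (a b : R) : 0 < a -> 0 < b -> a - b <= a * ln (a / b).
Proof.
move=> a0 b0; have ba0 : 0 < b / a by exact: divr_gt0.
have lnE : ln (a / b) = - ln (b / a) by rewrite -lnV ?posrE// invf_div.
have /le_ln1Dx : -1 < b / a - 1 by rewrite ltrBrDl subrr.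
rewrite [1 + _]addrC subrK.
rewrite -(ler_pM2l a0) mulrBr mulr1 mulrCA divff ?gt_eqF// mulr1 lnE.
by lra.
Qed.

(** * The minimiser and the lower bound for positive g *)

Definition logratio {R : realType} {n d : nat} (f g : jstate R n d -> R)
  (X : jstate R n d) : R := ln (symsum f X / symsum g X).

(** The symmetrised [f] shared out among the orderings of a configuration in the proportions given
    by [g]. *)
Definition tilted {R : realType} {n d : nat} (f g : jstate R n d -> R)
  (X : jstate R n d) : R := g X / symsum g X * symsum f X.

Lemma measurable_div {d} {T : measurableType d} {R : realType} (u v : T -> R) :
  measurable_fun setT u -> measurable_fun setT v -> (forall x, 0 < v x) ->
  measurable_fun setT (fun x => u x / v x).
Proof.
move=> mu mv v0; apply: measurable_funM => //.
(* For positive [v], the inverse is a composite of everywhere measurable functions. *)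
have -> : (fun x => (v x)^-1) = expR \o (fun x => - ln (v x)).
  by apply/funext => x /=; rewrite expRN lnK// posrE.
apply: measurableT_comp; first exact: measurable_expR.
by apply: measurableT_comp => //; exact: measurableT_comp.
Qed.

Lemma symsum_gt0 {R : realType} {n d : nat} (g : jstate R n d -> R) X :
  (forall Y, 0 < g Y) -> 0 < symsum g X.
Proof. by move=> g0; apply: lt_le_trans (le_symsum g X (fun Y => ltW (g0 Y))). Qed.

Lemma measurable_logratio {R : realType} {n d : nat} (f g : jstate R n d -> R) :
  measurable_fun setT f -> measurable_fun setT g -> (forall X, 0 < g X) ->
  measurable_fun setT (logratio f g).
Proof.
move=> mf mg g0; apply: measurableT_comp; first exact: measurable_ln.
apply: measurable_div => [||X]; [exact: measurable_symsum..|exact: symsum_gt0].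
Qed.

Lemma logratio_permX {R : realType} {n d : nat} (f g : jstate R n d -> R) p X :
  logratio f g (permX p X) = logratio f g X.
Proof. by rewrite /logratio !symsum_permX. Qed.

(** [logratio] is symmetric, so the integral sees [ft] only through [symsum ft], which feasibility
    fixes. *)
Lemma Jrhs_feasible {R : realType} {n d : nat}
  (lam : {measure set (jstate R n d) -> \bar R}) (f g ft : jstate R n d -> R) :
  is_lebesgue lam -> measurable_fun setT f -> measurable_fun setT g ->
  (forall X, 0 < g X) -> feasible lam f ft ->
  Jrhs lam f g = (\int[lam]_X (ft X * logratio f g X)%:E)%E.
Proof.
move=> hlam mf mg g0 [[mft [ft0 _]] sft].
rewrite (integral_symsum lam ft)//; last 2 first.
- exact: measurable_logratio.
- exact: logratio_permX.
rewrite /Jrhs; congr (_ * _)%E; apply: eq_integral => X _.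
by rewrite sft xlogxyE.
Qed.

Lemma tilted_feasible {R : realType} {n d : nat}
  (lam : {measure set (jstate R n d) -> \bar R}) (f g : jstate R n d -> R) :
  is_lebesgue lam -> is_density lam f -> measurable_fun setT g ->
  (forall X, 0 < g X) -> feasible lam f (tilted f g).
Proof.
move=> hlam [mf [f0 f1]] mg g0.
have G0 X : 0 < symsum g X by exact: symsum_gt0.
have F0 X : 0 <= symsum f X by exact: symsum_ge0.
have mw : measurable_fun setT (fun X => g X / symsum g X).
  by apply: measurable_div => //; exact: measurable_symsum.
have w0 X : 0 <= g X / symsum g X by rewrite divr_ge0 ?ltW.
(* The denominator is symmetric, so the proportions over all orderings add up to 1. *)
have sw X : symsum (fun X => g X / symsum g X) X = 1.
  rewrite /symsum -[RHS](divff (lt0r_neq0 (G0 X))) mulr_suml.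
  by apply: eq_bigr => p _; rewrite -/(symsum g _) symsum_permX.
split; last first.
  move=> X; rewrite -[RHS]mul1r -(sw X) /symsum mulr_suml.
  by apply: eq_bigr => p _; rewrite -!/(symsum _ _) /tilted !symsum_permX.
split; first by apply: measurable_funM => //; exact: measurable_symsum.
split; first by move=> X; rewrite mulr_ge0.
rewrite (integral_symsum lam (fun X => g X / symsum g X) (symsum f))//; last 2 first.
- exact: measurable_symsum.
- exact: symsum_permX.
(* The mass of [f], written against the symmetric function 1, is 1/n! times the integral of
   [symsum f], as is the mass of [tilted f g]. *)
have m1 : measurable_fun setT (cst 1 : jstate R n d -> R) by [].
have <- : (\int[lam]_X (f X * cst 1 X)%:E = 1)%E.
  by rewrite -f1; apply: eq_integral => X _; rewrite mulr1.
rewrite (integral_symsum lam f (cst 1))//.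
by congr (_ * _)%E; apply: eq_integral => X _; rewrite sw mul1r mulr1.
Qed.

Lemma KL_tilted {R : realType} {n d : nat}
  (lam : {measure set (jstate R n d) -> \bar R}) (f g : jstate R n d -> R) :
  is_lebesgue lam -> is_density lam f -> measurable_fun setT g ->
  (forall X, 0 < g X) -> KL lam (tilted f g) g = Jrhs lam f g.
Proof.
move=> hlam hf mg g0; have ft := tilted_feasible lam f g hlam hf mg g0.
have [mf _] := hf.
rewrite (Jrhs_feasible lam f g (tilted f g))//.
apply: eq_integral => X _; rewrite xlogxyE /logratio.
congr (_ * ln _)%:E; rewrite /tilted.
by field; rewrite !gt_eqF// symsum_gt0.
Qed.

Lemma le_KL {R : realType} {n d : nat}
  (lam : {measure set (jstate R n d) -> \bar R}) (f g ft : jstate R n d -> R) :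
  is_lebesgue lam -> is_density lam f -> measurable_fun setT g ->
  (forall X, 0 < g X) -> feasible lam f ft -> (Jrhs lam f g <= KL lam ft g)%E.
Proof.
move=> hlam hf mg g0 hft; have [mf _] := hf.
have [[mt [t0 t1]] st] := hft.
have [[ms [s0 s1]] _] := tilted_feasible lam f g hlam hf mg g0.
rewrite (Jrhs_feasible lam f g ft)//.
(* The shifts [ft] and [tilted f g] both have mass 1; what remains is pointwise. *)
apply: (le_integral_shift lam _ _ ft (tilted f g)) => //.
- rewrite [X in measurable_fun _ X](_ : _ = fun X => ft X * ln (ft X / g X)).
    apply: measurable_funM => //; apply: measurableT_comp; first exact: measurable_ln.
    exact: measurable_div.
  by apply/funext => X; rewrite xlogxyE.
- by apply: measurable_funM => //; exact: measurable_logratio.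
- by rewrite t1 s1.
- by rewrite s1 ltry.
move=> X; rewrite xlogxyE.
(* Where [ft] vanishes, the claim is that [tilted f g] is nonnegative. *)
have [->|tX0] := eqVneq (ft X) 0; first by rewrite !mul0r !add0r.
have tX : 0 < ft X by rewrite lt_neqAle eq_sym tX0 t0.
have FX : 0 < symsum f X by rewrite -st; apply: lt_le_trans tX (le_symsum ft X t0).
have GX : 0 < symsum g X by exact: symsum_gt0.
have sX : 0 < tilted f g X by rewrite mulr_gt0 ?divr_gt0.
have := gibbs _ _ tX sX.
(* Chain rule: ft / g = (F / G) (ft / (g F / G)), all factors being positive here. *)
suff -> : ln (ft X / g X) = logratio f g X + ln (ft X / tilted f g X).
  by rewrite mulrDr; lra.
rewrite -lnM ?posrE ?divr_gt0//; congr ln; rewrite /tilted.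
by field; rewrite !gt_eqF.
Qed.

(** * Gaussian g, including the degenerate normalisation *)

Lemma measurable_gauss {R : realType} {n d : nat} (mu : 'rV[R]_(n * d)) S :
  measurable_fun setT (@gauss R n d mu S).
Proof.
have mvec k : measurable_fun setT (fun X : jstate R n d => (vecX X - mu) 0 k).
  rewrite [X in measurable_fun _ X](_ : _ = fun X => vecX X 0 k + - mu 0 k).
    apply: measurable_funD => //; case/mxvec_indexP: k => i j.
    rewrite [X in measurable_fun _ X](_ : _ = fun X => coord X i j).
      exact: measurable_coord.
    by apply/funext => X; rewrite mxvecE mxE.
  by apply/funext => X; rewrite !mxE.
apply: measurable_funM => //; apply: measurableT_comp; first exact: measurable_expR.
apply: measurable_funM => //; apply: measurableT_comp => //.
(* The quadratic form is expanded into a polynomial in the coordinates. *)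
rewrite [X in measurable_fun _ X](_ : _ = fun X : jstate R n d =>
    \sum_k (\sum_l (vecX X - mu) 0 l * invmx S l k) * (vecX X - mu) 0 k).
  apply: measurable_sum => k; apply: measurable_funM => //.
  by apply: measurable_sum => l; apply: measurable_funM.
by apply/funext => X; rewrite mxE; apply: eq_bigr => k _; rewrite mxE [in X in _ * X]mxE.
Qed.

(* The second case is the junk value x / 0 = 0 of a vanishing normalising
   constant; KL and Jrhs are then both 0, which spares us det S > 0. *)
Lemma gauss_gt0_or_eq0 {R : realType} {n d : nat} (mu : 'rV[R]_(n * d)) S :
  (forall X : jstate R n d, 0 < gauss mu S X) \/
  (forall X : jstate R n d, gauss mu S X = 0).
Proof.
have [c0|c0] := eqVneq (Num.sqrt ((2 * pi) ^+ (n * d) * \det S)) 0.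
  by right=> X; rewrite /gauss c0 invr0 mulr0.
left=> X; rewrite /gauss divr_gt0 ?expR_gt0//.
by rewrite lt_neqAle eq_sym c0 sqrtr_ge0.
Qed.

(** By the conventions x / 0 = 0 and ln 0 = 0, the integrand vanishes. *)
Lemma KL0 {R : realType} {n d : nat}
  (lam : {measure set (jstate R n d) -> \bar R}) (h g : jstate R n d -> R) :
  (forall X, g X = 0) -> KL lam h g = 0%E.
Proof.
move=> g0; apply: integral0_eq => X _.
by rewrite xlogxyE g0 invr0 mulr0 ln0// mulr0.
Qed.

Lemma Jrhs0 {R : realType} {n d : nat}
  (lam : {measure set (jstate R n d) -> \bar R}) (f g : jstate R n d -> R) :
  (forall X, g X = 0) -> Jrhs lam f g = 0%E.
Proof.
move=> g0; rewrite /Jrhs -/(KL lam (symsum f) (symsum g)) KL0 ?mule0// => X.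
by rewrite /symsum big1.
Qed.

Lemma Jrhs_is_min {R : realType} {n d : nat}
  (lam : {measure set (jstate R n d) -> \bar R}) (f : jstate R n d -> R)
  (mu : 'rV[R]_(n * d)) (S : 'M[R]_(n * d)) :
  is_lebesgue lam -> is_density lam f ->
  (exists ft, feasible lam f ft /\ KL lam ft (gauss mu S) = Jrhs lam f (gauss mu S)) /\
  (forall ft, feasible lam f ft -> (Jrhs lam f (gauss mu S) <= KL lam ft (gauss mu S))%E).
Proof.
move=> hlam hf; have mg := measurable_gauss mu S.
have [g0|g0] := gauss_gt0_or_eq0 (n := n) (d := d) mu S.
  split; last by move=> ft; exact: le_KL.
  exists (tilted f (gauss mu S)); split; first exact: tilted_feasible.
  exact: KL_tilted.
split; last by move=> ft _; rewrite Jrhs0// KL0.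
(* In the degenerate case both sides are 0, and [f] itself serves as a feasible density. *)
by exists f; split; [split | rewrite Jrhs0// KL0].
Qed.

Theorem theorem7 (R : realType) (n d : nat) (hn : (1 <= n)%N) (hd : (1 <= d)%N)
  (lam : {measure set (jstate R n d) -> \bar R}) (hlam : is_lebesgue lam)
  (f : jstate R n d -> R) (hf : is_density lam f) :
  (* J(g) is a minimum and equals the closed form, for every Gaussian g *)
  (forall (mu : 'rV[R]_(n * d)) (S : 'M[R]_(n * d)), spd S ->
     (exists ft, feasible lam f ft /\ KL lam ft (gauss mu S) = Jrhs lam f (gauss mu S))
     /\ (forall ft, feasible lam f ft ->
           (Jrhs lam f (gauss mu S) <= KL lam ft (gauss mu S))%E))
  /\
  (* consequently: joint minimisation over (ft, g) equals minimisation of the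
     right-hand side over Gaussian g, with corresponding minimisers *)
  (ereal_inf (joint_values lam f) = ereal_inf (reduced_values lam f))
  /\
  (forall (mu : 'rV[R]_(n * d)) (S : 'M[R]_(n * d)), spd S ->
     ((exists ft, feasible lam f ft /\
        KL lam ft (gauss mu S) = ereal_inf (joint_values lam f))
      <->
      Jrhs lam f (gauss mu S) = ereal_inf (reduced_values lam f))).
Proof.
have J_min mu S := Jrhs_is_min lam f mu S hlam hf.
(* Each reduced value is attained as a joint value, and each joint value dominates the reduced value
   of the same Gaussian. *)
have inf_eq : ereal_inf (joint_values lam f) = ereal_inf (reduced_values lam f).
  apply/eqP; rewrite eq_le; apply/andP; split; apply/ereal_infP.
    move=> _ [mu [S [hS ->]]]; have [[ft [hft <-]] _] := J_min mu S.
    by apply: ereal_inf_lbound; exists ft, mu, S.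
  move=> _ [ft [mu [S [hft hS ->]]]]; have [_ /(_ ft hft)] := J_min mu S.
  by apply: le_trans; apply: ereal_inf_lbound; exists mu, S.
split; first by move=> mu S _; exact: J_min.
split => // mu S hS; have [[ft [hft KLE]] J_le] := J_min mu S.
split=> [[ft' [hft' KLE']]|JE]; last by exists ft; rewrite KLE JE inf_eq.
(* [Jrhs] lies below the optimal value attained by [ft'], and above the infimum by definition. *)
apply/eqP; rewrite eq_le -{1}inf_eq -KLE' J_le//=.
by apply: ereal_inf_lbound; exists mu, S.
Qed.
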